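(* Let $n\ge 2$. Let $F:\operatorname{Max}\mathcal{L}_n(\underline{32}1)\to\operatorname{Max}\mathcal{L}_n(3\underline{21})$ be given by $$F:=\Delta_{3\underline{21}}^{-1}\circ\Phi\circ\Delta_{\underline{32}1},\qquad\text{where }\Phi(D)=\{n-d: d\in D\}.$$ Then the mapping $F$ is a bijection. Furthermore, $F$ corresponds to taking the reverse-complement of the associated permutation: for every $p\in\operatorname{Max}\mathcal{L}_n(\underline{32}1)$, if $\pi\in\mathcal{S}_n$ is the permutation with $L(\pi)=p$, then $$F(p)=L(\pi^{r.c}).$$ As a consequence, $w(p)=w(F(p))$.
   Context: $[n]=\{1,\dots,n\}$ and $\mathcal{S}_n$ is the set of permutations $\pi=\pi_1\pi_2\cdots\pi_n$ of $[n]$. The set of Lehmer codes of length $n$ is $\mathcal{L}_n=\{(p_1,\dots,p_n)\in\mathbb{Z}^n: 0\le p_i\le n-i \text{ for } 1\le i\le n\}$. The Lehmer code of $\pi\in\mathcal{S}_n$ is $L(\pi)=(p_1,\dots,p_n)$ with $p_i=|\{j>i:\pi_j<\pi_i\}|$; the map $L:\mathcal{S}_n\to\mathcal{L}_n$ is a bijection. The weight of a code is $w(p)=\sum_{i=1}^n p_i$. A permutation $\pi$ avoids the vincular pattern $\underline{32}1$ if there are no indices $i,k$ with $i+1<k\le n$ and $\pi_i>\pi_{i+1}>\pi_k$. It avoids $3\underline{21}$ if there are no indices $i<j\le n-1$ with $\pi_i>\pi_j>\pi_{j+1}$. For $\tau\in\{\underline{32}1,3\underline{21}\}$, $\mathcal{S}_n(\tau)$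 is the set of $\tau$-avoiding permutations in $\mathcal{S}_n$ and $\mathcal{L}_n(\tau)=\{L(\pi):\pi\in\mathcal{S}_n(\tau)\}$. The set $\mathcal{L}_n(\tau)$ is partially ordered by $s\preceq t$ iff $s_i\le t_i$ for all $i$, and $\operatorname{Max}\mathcal{L}_n(\tau)$ denotes its set of maximal elements. The descent set of $p\in\mathcal{L}_n$ is $D(p)=\{j\in[n-1]:p_j>p_{j+1}\}$. Put $\mathcal{D}_n(\tau)=\{D(p):p\in\operatorname{Max}\mathcal{L}_n(\tau)\}$ and define $\Delta_\tau:\operatorname{Max}\mathcal{L}_n(\tau)\to\mathcal{D}_n(\tau)$ by $\Delta_\tau(p)=D(p)$. The definition of $F$ presupposes that $\Delta_{3\underline{21}}$ is invertible and that $\Phi$ maps $\mathcal{D}_n(\underline{32}1)$ into $\mathcal{D}_n(3\underline{21})$; thus $F(p)$ is the unique $s\in\operatorname{Max}\mathcal{L}_n(3\underline{21})$ with $D(s)=\Phi(D(p))$. The reverse of $\pi$ is $\pi^r=\pi_n\pi_{n-1}\cdots\pi_1$, the complement is $\pi^c$ with $(\pi^c)_k=n+1-\pi_k$, and the reverse-complement is $\pi^{r.c}=(\pi^r)^c$, i.e. $(\pi^{r.c})_k=n+1-\pi_{n+1-k}$. *)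

(* Defs.v *)
From mathcomp Require Import all_boot all_fingroup.

Set Implicit Arguments.
Unset Strict Implicit.
Unset Printing Implicit Defensive.

(* Permutations of [n] are elements of 'S_n, with both positions and values
   shifted down by one, i.e. ranging over 'I_n = {0, ..., n-1}. *)

(* The entry at 0-based position i is at most n - (i + 1), i.e. lies in
   'I_(n - i), so this type is exactly the set of Lehmer codes of length n. *)
Definition lehmer_code (n : nat) := {dffun forall i : 'I_n, 'I_(n - i)}.

Lemma card_inversions_ltn (n : nat) (pi : 'S_n) (i : 'I_n) :
  #|[set j : 'I_n | (i < j) && (pi j < pi i)]| < n - i.
Proof.
have le_gt : #|[set j : 'I_n | (i < j) && (pi j < pi i)]|
             <= #|[set j : 'I_n | i < j]|.
  by apply/subset_leq_card/subsetP => j; rewrite !inE => /andP[].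
have card_le : #|[set j : 'I_n | j < i.+1]| = i.+1.
  have widen_inj : injective (widen_ord (ltn_ord i)).
    by move=> x y /(congr1 val) eq_xy; apply: val_inj.
  rewrite -[RHS]card_ord -(card_imset _ widen_inj).
  apply: eq_card => j; rewrite inE; apply/idP/imsetP => [lt_ji | [k _ ->]].
    by exists (Ordinal lt_ji) => //; apply: val_inj.
  exact: (ltn_ord k).
have eqC : ~: [set j : 'I_n | j < i.+1] = [set j : 'I_n | i < j].
  by apply/setP => j; rewrite !inE -leqNgt.
have := cardsC [set j : 'I_n | j < i.+1].
rewrite eqC card_le card_ord => eq_n.
apply: leq_ltn_trans le_gt _.
by rewrite ltn_subRL -[X in _ < X]eq_n addSn ltnS.
Qed.

Definition lehmer (n : nat) (pi : 'S_n) : lehmer_code n :=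
  [ffun i : 'I_n => Ordinal (card_inversions_ltn pi i)].

Definition weight (n : nat) (p : lehmer_code n) : nat := \sum_(i < n) p i.

(* The two vincular patterns; the adjacent (underlined) letters are
   3 and 2 in V32_1, and 2 and 1 in V3_21. *)
Inductive vincular := V32_1 | V3_21.

Definition contains (n : nat) (tau : vincular) (pi : 'S_n) : bool :=
  [exists i : 'I_n, exists j : 'I_n, exists k : 'I_n,
     [&& i < j, j < k,
         match tau with
         | V32_1 => j == i.+1 :> nat
         | V3_21 => k == j.+1 :> nat
         end,
         pi j < pi i & pi k < pi j]].

Definition S_avoiding (n : nat) (tau : vincular) : {set 'S_n} :=
  [set pi : 'S_n | ~~ contains tau pi].

Definition L_avoiding (n : nat) (tau : vincular) : {set lehmer_code n} :=
  [set lehmer pi | pi in S_avoiding n tau].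

Definition code_le (n : nat) (s t : lehmer_code n) : bool :=
  [forall i : 'I_n, s i <= t i].

Definition MaxL (n : nat) (tau : vincular) : {set lehmer_code n} :=
  [set p in L_avoiding n tau |
     [forall q in L_avoiding n tau, code_le p q ==> (q == p)]].

(* Descents keep their 1-based labels: d : 'I_n with 0 < d stands for the
   element d of [n-1], which compares the 0-based positions d - 1 and d.
   The element 0 of 'I_n never belongs to a descent set. *)
Definition descents (n : nat) (p : lehmer_code n) : {set 'I_n} :=
  [set d : 'I_n | [exists i : 'I_n, (d == i.+1 :> nat) && (p d < p i)]].

Definition Dset (n : nat) (tau : vincular) : {set {set 'I_n}} :=
  [set descents p | p in MaxL n tau].

Definition Phi (n : nat) (D : {set 'I_n}) : {set 'I_n} :=
  [set e : 'I_n | [exists d in D, e == n - d :> nat]].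

(* Partial inverse of the restriction of descents to MaxL n tau. *)
Definition descents_inv (n : nat) (tau : vincular) (D : {set 'I_n}) :
    option (lehmer_code n) :=
  [pick s in MaxL n tau | descents s == D].

(* The default value p is irrelevant on MaxL n V32_1 as soon as Phi maps
   Dset n V32_1 into Dset n V3_21. *)
Definition F (n : nat) (p : lehmer_code n) : lehmer_code n :=
  odflt p (descents_inv V3_21 (Phi (descents p))).

Definition reversal (n : nat) : 'S_n := perm (@rev_ord_inj n).

(* Products of permutations compose from left to right:
   (s * t) k = t (s k). *)
Definition reverse (n : nat) (pi : 'S_n) : 'S_n := (reversal n * pi)%g.
Definition complement (n : nat) (pi : 'S_n) : 'S_n := (pi * reversal n)%g.
Definition reverse_complement (n : nat) (pi : 'S_n) : 'S_n :=
  complement (reverse pi).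

(* Main.v *)
Require Import Defs.
From mathcomp Require Import all_boot all_fingroup.
From mathcomp Require Import zify.

Set Implicit Arguments.
Unset Strict Implicit.
Unset Printing Implicit Defensive.

(** Reverse-complement exchanges the two classes of pattern-avoiding
    permutations, but the entrywise order on codes is not invariant under it: the
    code counts inversions by their left end, and reverse-complement turns left
    ends into right ends. What has to be shown is that maximality survives
    nevertheless.

    The inversion set is what the two sides share. If [pi] avoids 32-1 and has
    descent set [D], then a descent bottom starts no inversion, and every
    inversion (i, j) contains a descent d with i < d <= j. Conversely, the pairs
    (i, j) with i not in D and i < d <= j for some d in D are exactly the
    inversions of a permutation [block_perm D] ([inversion_block_perm]), which
    avoids 32-1. So inside the class each [pi] lies below [block_perm] of its
    descent set for inclusion of inversion sets ([inversion_sub_block_perm]),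
    hence for the code order on both sides. All maximal codes on either side
    therefore come from permutations [block_perm D], with [D] free of two
    consecutive elements.

    Between two of these, the code order, the code order after
    reverse-complement, and the inclusion of inversion sets all amount to the
    same thing: [D] is an initial segment of [E] ([code_le_block_perm],
    [code_le_reverse_complement_block_perm]). Hence the same sets [D] give the
    maximal codes of both classes ([MaxL_V32_1], [MaxL_V3_21]). Since
    reverse-complement acts on descent sets by [Phi], the map [F] sends the code
    of [block_perm D] to the code of its reverse-complement. Weights agree because
    reverse-complement preserves the number of inversions, and injectivity of the
    Lehmer code ([lehmer_inj]) identifies the permutation behind a given code. *)

(** * Inversions and the Lehmer code *)

Definition inversion (n : nat) (pi : 'S_n) (i j : 'I_n) : bool :=
  (i < j) && (pi j < pi i).

Lemma lehmerE (n : nat) (pi : 'S_n) (i : 'I_n) :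
  lehmer pi i = #|[set j | inversion pi i j]| :> nat.
Proof. by rewrite ffunE. Qed.

Lemma eq_perm_val_ltn (n : nat) (pi : 'S_n) (i j : 'I_n) :
  i != j -> (pi j < pi i) = ~~ (pi i < pi j).
Proof.
move=> neq_ij; rewrite -leqNgt ltn_neqAle.
suff -> : (pi j != pi i :> nat) by [].
by apply: contra neq_ij => /eqP/val_inj/perm_inj ->.
Qed.

(** If two permutations agree before position [i], they have the same set
    [V] of values left at positions [i] and beyond, and the code entry at [i]
    is the rank in [V] of the value taken at [i]. *)
Lemma lehmer_inj (n : nat) : injective (@lehmer n).
Proof.
move=> pi rho eq_code; apply/permP => i.
(* Strong induction on the position: [agree] is the hypothesis. *)
have [m] := ubnP i; elim: m i => // m IHm i lt_im.
have agree (j : 'I_n) : j < i -> pi j = rho j.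
  by move=> lt_ji; apply: IHm; apply: leq_trans lt_ji _.
pose V (s : 'S_n) := s @: [set j : 'I_n | i <= j].
have eqV : V pi = V rho.
  have VE (s : 'S_n) : V s = ~: (s @: [set j : 'I_n | j < i]).
    apply/setP => v; rewrite -[v](permKV s) inE !mem_imset ?inE -?leqNgt //;
      exact: perm_inj.
  rewrite !VE; congr (~: _); apply: eq_in_imset => j.
  by rewrite inE => /agree.
have rankE (s : 'S_n) : lehmer s i = #|[set v in V s | v < s i]| :> nat.
  rewrite lehmerE -[LHS](card_imset _ (@perm_inj _ s)); apply: eq_card => v.
  rewrite !inE /V; apply/imsetP/andP => [[j] | [/imsetP[j]]].
    rewrite inE => /andP[lt_ij lt_sj ->]; split=> //.
    by apply: imset_f; rewrite inE ltnW.
  rewrite inE => le_ij -> lt_sj; exists j => //.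
  rewrite inE /inversion lt_sj andbT ltn_neqAle le_ij andbT.
  by apply: contraTneq lt_sj => /val_inj ->; rewrite ltnn.
have lt_rank (s t : 'S_n) :
    V s = V t -> s i < t i -> lehmer s i < lehmer t i.
  move=> eqVst lt_st; rewrite !rankE -eqVst; apply: proper_card.
  apply/properP; split.
    apply/subsetP => v; rewrite !inE => /andP[-> /ltn_trans]; exact.
  exists (s i); rewrite !inE ?ltnn ?andbF // lt_st andbT.
  by apply: imset_f; rewrite inE.
apply: val_inj; case: (ltngtP (pi i) (rho i)) => // lt_v.
  by have := lt_rank _ _ eqV lt_v; rewrite eq_code ltnn.
by have := lt_rank _ _ (esym eqV) lt_v; rewrite eq_code ltnn.
Qed.

Lemma code_le_inversion (n : nat) (pi rho : 'S_n) :
  (forall i j, inversion pi i j -> inversion rho i j) ->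
  code_le (lehmer pi) (lehmer rho).
Proof.
move=> sub_inv; apply/forallP => i; rewrite !lehmerE subset_leq_card //.
by apply/subsetP => j; rewrite !inE; apply: sub_inv.
Qed.

Lemma code_le_anti (n : nat) (s t : lehmer_code n) :
  code_le s t -> code_le t s -> s = t.
Proof.
move=> /forallP le_st /forallP le_ts; apply/ffunP => i; apply: val_inj.
by apply/eqP; rewrite eqn_leq le_st le_ts.
Qed.

Lemma code_le_trans (n : nat) (s t u : lehmer_code n) :
  code_le s t -> code_le t u -> code_le s u.
Proof.
move=> /forallP le_st /forallP le_tu; apply/forallP => i.
exact: leq_trans (le_st i) (le_tu i).
Qed.

(** For consecutive positions, an inversion starting at the smaller of the two
    values also starts at the larger one; so the code descends exactly where the
    permutation does. *)
Lemma descentsP (n : nat) (pi : 'S_n) (d : 'I_n) :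
  reflect (exists2 i : 'I_n, d = i.+1 :> nat & inversion pi i d)
          (d \in descents (lehmer pi)).
Proof.
suff step (i : 'I_n) :
    d = i.+1 :> nat -> (lehmer pi d < lehmer pi i) = (pi d < pi i).
  rewrite inE; apply: (iffP existsP) => [[i /andP[/eqP eq_d]] | [i eq_d]].
    by rewrite step // => lt_d; exists i => //; rewrite /inversion eq_d leqnn.
  by move=> /andP[_ lt_d]; exists i; rewrite step // lt_d andbT; apply/eqP.
move=> eq_d; have neq_id : i != d by rewrite -val_eqE /= eq_d; lia.
rewrite !lehmerE; case: (boolP (pi d < pi i)) => [lt_d | ].
  apply: proper_card; apply/properP; split.
    apply/subsetP => j; rewrite !inE /inversion; lia.
  by exists d; rewrite !inE /inversion ?ltnn // lt_d eq_d leqnn.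
rewrite (eq_perm_val_ltn _ neq_id) negbK => lt_i.
apply/negbTE; rewrite -leqNgt subset_leq_card //; apply/subsetP => j.
rewrite !inE /inversion; case: (eqVneq j d) => [-> | ]; first by lia.
by rewrite -val_eqE /=; lia.
Qed.

(** * Reverse-complement *)

Lemma reverse_complementE (n : nat) (pi : 'S_n) (i : 'I_n) :
  reverse_complement pi i = rev_ord (pi (rev_ord i)).
Proof. by rewrite /reverse_complement /complement /reverse !permM !permE. Qed.

Lemma reverse_complementK (n : nat) : involutive (@reverse_complement n).
Proof. by move=> pi; apply/permP => i; rewrite !reverse_complementE !rev_ordK. Qed.

Lemma inversion_reverse_complement (n : nat) (pi : 'S_n) (i j : 'I_n) :
  inversion (reverse_complement pi) i j = inversion pi (rev_ord j) (rev_ord i).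
Proof.
rewrite /inversion !reverse_complementE /=.
have := ltn_ord (pi (rev_ord i)); have := ltn_ord (pi (rev_ord j)).
have := ltn_ord i; have := ltn_ord j; lia.
Qed.

(** The reversed code of the reverse-complement counts the inversions of [pi] by
    their right end. This is the form in which the two code orders are compared. *)
Lemma lehmer_reverse_complement (n : nat) (pi : 'S_n) (j : 'I_n) :
  lehmer (reverse_complement pi) (rev_ord j) = #|[set i | inversion pi i j]|
    :> nat.
Proof.
rewrite lehmerE -[LHS](card_imset _ (@rev_ord_inj n)); apply: eq_card => i.
rewrite inE; apply/imsetP/idP => [[k] | inv_ij].
  by rewrite inE inversion_reverse_complement rev_ordK => ? ->.
by exists (rev_ord i); rewrite ?rev_ordK // inE inversion_reverse_complement
  !rev_ordK.
Qed.

Lemma containsP (n : nat) (tau : vincular) (pi : 'S_n) :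
  reflect (exists i j k : 'I_n, [/\ inversion pi i j, inversion pi j k
             & if tau is V32_1 then j == i.+1 :> nat else k == j.+1 :> nat])
          (contains tau pi).
Proof.
apply: (iffP existsP) => [[i /existsP[j /existsP[k]]] | [i [j [k []]]]].
  case/and5P=> lt_ij lt_jk adj lt_ji lt_kj; exists i, j, k.
  by rewrite /inversion lt_ij lt_jk lt_ji lt_kj; case: tau adj.
move=> /andP[lt_ij lt_ji] /andP[lt_jk lt_kj] adj; exists i; apply/existsP.
exists j; apply/existsP; exists k; rewrite lt_ij lt_jk lt_ji lt_kj !andbT.
by case: tau adj.
Qed.

(** Reading an occurrence backwards and upside down turns a consecutive 32
    followed by a 1 into a 3 followed by a consecutive 21. *)
Lemma contains_reverse_complement (n : nat) (pi : 'S_n) :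
  contains V3_21 (reverse_complement pi) = contains V32_1 pi.
Proof.
apply/containsP/containsP => -[i [j [k [inv_ij inv_jk adj]]]];
  exists (rev_ord k), (rev_ord j), (rev_ord i);
  move: inv_ij inv_jk; rewrite ?inversion_reverse_complement ?rev_ordK;
  split=> //; apply/eqP; move/eqP: adj => /=;
  have := ltn_ord k; have := ltn_ord j; lia.
Qed.

Lemma L_avoiding_V3_21 (n : nat) (q : lehmer_code n) :
  reflect (exists2 pi, pi \in S_avoiding n V32_1
                     & q = lehmer (reverse_complement pi))
          (q \in L_avoiding n V3_21).
Proof.
apply: (iffP imsetP) => [[pi] | [pi]]; rewrite inE => av_pi eq_q.
  exists (reverse_complement pi); last by rewrite reverse_complementK.
  by rewrite inE -contains_reverse_complement reverse_complementK.
by exists (reverse_complement pi); rewrite // inE contains_reverse_complement.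
Qed.

Lemma descents_gt0 (n : nat) (p : lehmer_code n) (d : 'I_n) :
  d \in descents p -> 0 < d.
Proof. by rewrite inE => /existsP[i /andP[/eqP eq_d _]]; rewrite eq_d. Qed.

(** Descents are labelled from 1, so [Phi] is the reflection d |-> n - d and not
    [rev_ord]; the label 0 has no image. *)
Lemma mem_Phi (n : nat) (D : {set 'I_n}) (e d : 'I_n) :
  e + d = n -> (e \in Phi D) = (d \in D).
Proof.
move=> eq_n; rewrite inE; apply/existsP/idP => [[x /andP[xD /eqP eq_e]] | dD].
  suff <- : x = d by [].
  by apply: val_inj => /=; have := ltn_ord x; lia.
by exists d; rewrite dD; apply/eqP; lia.
Qed.

Lemma Phi_inj (n : nat) (D E : {set 'I_n}) :
  (forall d, d \in D -> 0 < d) -> (forall d, d \in E -> 0 < d) ->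
  Phi D = Phi E -> D = E.
Proof.
move=> D_gt0 E_gt0 eq_Phi; apply/setP => d.
case: (posnP d) => [d0 | d_gt0].
  by apply/idP/idP => [/D_gt0 | /E_gt0]; rewrite d0.
have lt_n : n - d < n by have := ltn_ord d; lia.
have eq_n : Ordinal lt_n + d = n by have := ltn_ord d => /=; lia.
by rewrite -!(mem_Phi _ eq_n) eq_Phi.
Qed.

Lemma descents_reverse_complement (n : nat) (pi : 'S_n) :
  descents (lehmer (reverse_complement pi)) = Phi (descents (lehmer pi)).
Proof.
apply/setP => e; case: (posnP e) => [e0 | e_gt0].
  apply/idP/idP => [/descents_gt0 | ]; first by rewrite e0.
  rewrite inE => /existsP[x /andP[_ /eqP]]; have := ltn_ord x; lia.
have lt_n : n - e < n by have := ltn_ord e; lia.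
have eq_n : e + Ordinal lt_n = n by have := ltn_ord e => /=; lia.
rewrite (mem_Phi _ eq_n).
have rev_d (i : 'I_n) : Ordinal lt_n = i.+1 :> nat -> rev_ord e = i.
  by move=> /= eq_i; apply: val_inj => /=; have := ltn_ord e; lia.
have rev_e (i : 'I_n) : e = i.+1 :> nat -> rev_ord i = Ordinal lt_n.
  by move=> eq_i; apply: val_inj => /=; have := ltn_ord e; lia.
apply/descentsP/descentsP => -[i eq_i].
  rewrite inversion_reverse_complement (rev_e _ eq_i) => inv_e.
  by exists (rev_ord e) => //=; have := ltn_ord e; lia.
rewrite -(rev_d _ eq_i) => inv_e; exists (rev_ord (Ordinal lt_n)).
  by move=> /=; have := ltn_ord e; lia.
by rewrite inversion_reverse_complement rev_ordK.
Qed.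

(** Weight is the number of inversions, and reverse-complement permutes the
    inversions. *)
Lemma weight_reverse_complement (n : nat) (pi : 'S_n) :
  weight (lehmer (reverse_complement pi)) = weight (lehmer pi).
Proof.
rewrite /weight (reindex_inj (@rev_ord_inj n)) /=.
under eq_bigr do rewrite lehmer_reverse_complement -sum1_card.
under [RHS]eq_bigr do rewrite lehmerE -sum1_card.
rewrite (exchange_big_dep predT) //=; apply: eq_bigr => i _.
by apply: eq_bigl => j; rewrite !inE.
Qed.

(** * The permutation with blocks cut at a descent set *)

(** Ranking the positions by an injective key gives the permutation whose
    values are ordered as the keys. *)
Definition key_rank (n : nat) (key : 'I_n -> nat) (i : 'I_n) : nat :=
  #|[set j | key j < key i]|.

Lemma key_rank_ltn (n : nat) (key : 'I_n -> nat) (i j : 'I_n) :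
  (key_rank key i < key_rank key j) = (key i < key j).
Proof.
have sub (k l : 'I_n) : key k <= key l ->
    [set x | key x < key k] \subset [set x | key x < key l].
  by move=> le_kl; apply/subsetP => x; rewrite !inE => /leq_trans; apply.
case: (ltnP (key i) (key j)) => [lt_ij | le_ji]; last first.
  by apply/negbTE; rewrite -leqNgt subset_leq_card ?sub.
apply: proper_card; apply/properP; split; first by rewrite sub // ltnW.
by exists i; rewrite !inE ?ltnn.
Qed.

Lemma key_rank_max (n : nat) (key : 'I_n -> nat) (i : 'I_n) :
  key_rank key i < n.
Proof.
rewrite -[X in _ < X]card_ord -cardsT; apply: proper_card.
by apply/properP; split; [apply: subsetT | exists i; rewrite !inE ?ltnn].
Qed.

Lemma key_rank_inj (n : nat) (key : 'I_n -> nat) :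
  injective key -> injective (fun i => Ordinal (key_rank_max key i)).
Proof.
move=> key_inj i j [eq_rank]; apply: key_inj.
by case: (ltngtP (key i) (key j)) => //; rewrite -key_rank_ltn eq_rank ltnn.
Qed.

(** The positions in [D] get the smallest keys, in increasing order. The others
    are ordered by blocks: the number of elements of [D] up to [i] says in which
    block [i] lies, later blocks have smaller keys, and inside a block the keys
    increase with the position. The count is at most [n], so the factor of [n] is
    at least 1, and these keys exceed all positions. *)
Definition block_key (n : nat) (D : {set 'I_n}) (i : 'I_n) : nat :=
  if i \in D then i : nat else n * (n.+1 - #|[set d in D | d <= i]|) + i.

Lemma block_key_ltn (n : nat) (D : {set 'I_n}) (i j : 'I_n) :
  i < j -> (block_key D j < block_key D i) =
           (i \notin D) && [exists d in D, i < d <= j].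
Proof.
move=> lt_ij; have lt_jn := ltn_ord j.
have card_le (k : 'I_n) : #|[set d in D | d <= k]| <= n.
  by rewrite -[X in _ <= X]card_ord max_card.
have := card_le i; have := card_le j; rewrite /block_key.
case: (boolP (i \in D)) => /= iD; first by case: ifP => _ *; nia.
case: (boolP (j \in D)) => jD le_j le_i.
  have -> : [exists d in D, i < d <= j].
    by apply/existsP; exists j; rewrite jD lt_ij leqnn.
  nia.
have sub : [set d in D | d <= i] \subset [set d in D | d <= j].
  by apply/subsetP => d; rewrite !inE => /andP[->] /=; lia.
case: (boolP [exists d in D, _]) => [/existsP[d /and3P[dD lt_id le_dj]] | noD].
  have lt_card : #|[set d in D | d <= i]| < #|[set d in D | d <= j]|.
    apply: proper_card; apply/properP; split=> //.
    by exists d; rewrite !inE dD //= -ltnNge.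
  move: lt_card le_j le_i; move: #|_| #|_| => b a lt_ab le_b _.
  have : n * (n.+1 - b).+1 <= n * (n.+1 - a) by rewrite leq_mul2l; lia.
  by rewrite mulnS; lia.
suff -> : [set d in D | d <= j] = [set d in D | d <= i].
  by rewrite ltn_add2l; lia.
apply/eqP; rewrite eqEsubset sub andbT; apply/subsetP => d.
rewrite !inE => /andP[dD le_dj]; rewrite dD /=; apply: contraR noD.
by rewrite -ltnNge => lt_id; apply/existsP; exists d; rewrite dD lt_id.
Qed.

Lemma block_key_inj (n : nat) (D : {set 'I_n}) : injective (block_key D).
Proof.
have key_mod (k : 'I_n) : block_key D k %% n = k.
  rewrite /block_key; case: ifP => _; first by rewrite modn_small.
  by rewrite mulnC modnMDl modn_small.
by move=> i j eq_key; apply: val_inj; rewrite /= -key_mod eq_key key_mod.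
Qed.

Definition block_perm (n : nat) (D : {set 'I_n}) : 'S_n :=
  perm (key_rank_inj (@block_key_inj n D)).

(** The inversion set of [block_perm D]. It is the largest that a 32-1-avoiding
    permutation with descent set [D] can have. *)
Lemma inversion_block_perm (n : nat) (D : {set 'I_n}) (i j : 'I_n) :
  inversion (block_perm D) i j = (i \notin D) && [exists d in D, i < d <= j].
Proof.
rewrite /inversion !permE /= key_rank_ltn.
case: (ltnP i j) => [/block_key_ltn -> // | le_ji].
apply/esym/negbTE; rewrite negb_and; apply/orP; right.
by apply/existsP => -[d /and3P[_]]; lia.
Qed.

Lemma ord_predecessor (n : nat) (d : 'I_n) :
  0 < d -> exists c : 'I_n, d = c.+1 :> nat.
Proof.
move=> d_gt0; have lt_n : d.-1 < n by have := ltn_ord d; lia.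
by exists (Ordinal lt_n); rewrite /= prednK.
Qed.

(** The shape of descent sets of 32-1-avoiding permutations: two consecutive
    descents would be a 321 on consecutive positions. *)
Definition sparse (n : nat) (D : {set 'I_n}) : Prop :=
  (forall d, d \in D -> 0 < d) /\
  (forall c d : 'I_n, d = c.+1 :> nat -> d \in D -> c \notin D).

Lemma block_perm_avoids (n : nat) (D : {set 'I_n}) :
  block_perm D \in S_avoiding n V32_1.
Proof.
rewrite inE; apply/containsP => -[i [j [k []]]].
rewrite !inversion_block_perm => /andP[_ /existsP[d /and3P[dD lt_id le_dj]]].
move=> /andP[jND _] /eqP eq_j; move: jND.
suff <- : d = j by rewrite dD.
by apply: val_inj => /=; lia.
Qed.

Lemma descents_block_perm (n : nat) (D : {set 'I_n}) :
  sparse D -> descents (lehmer (block_perm D)) = D.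
Proof.
move=> [D_gt0 D_sep]; apply/setP => d; apply/descentsP/idP => [[i eq_d] | dD].
  rewrite inversion_block_perm => /andP[_ /existsP[e /and3P[eD lt_ie le_ed]]].
  suff <- : e = d by [].
  by apply: val_inj => /=; lia.
have [c eq_d] := ord_predecessor (D_gt0 _ dD); exists c => //.
rewrite inversion_block_perm (D_sep _ _ eq_d dD).
by apply/existsP; exists d; rewrite dD eq_d !leqnn.
Qed.

Lemma avoiding_inversion (n : nat) (pi : 'S_n) (i j k : 'I_n) :
  pi \in S_avoiding n V32_1 -> j = i.+1 :> nat ->
  inversion pi i j -> ~~ inversion pi j k.
Proof.
rewrite inE => av_pi eq_j inv_ij; apply: contra av_pi => inv_jk.
by apply/containsP; exists i, j, k; rewrite eq_j.
Qed.

Lemma sparse_descents (n : nat) (pi : 'S_n) :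
  pi \in S_avoiding n V32_1 -> sparse (descents (lehmer pi)).
Proof.
move=> av_pi; split=> [|c d eq_d /descentsP[i eq_i inv_id]].
  exact: descents_gt0.
have -> : c = i by apply: val_inj => /=; lia.
by apply/descentsP => -[k eq_k /(avoiding_inversion d av_pi eq_k)/negP].
Qed.

(** If [i] were a descent bottom, the descent followed by [pi j] would be a 32-1;
    and if no descent lay between [i] and [j], the values would increase from one
    to the other. *)
Lemma inversion_sub_block_perm (n : nat) (pi : 'S_n) (i j : 'I_n) :
  pi \in S_avoiding n V32_1 -> inversion pi i j ->
  inversion (block_perm (descents (lehmer pi))) i j.
Proof.
move=> av_pi inv_ij; rewrite inversion_block_perm; apply/andP; split.
  apply/descentsP => -[k eq_k inv_ki].
  by move: (avoiding_inversion j av_pi eq_k inv_ki); rewrite inv_ij.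
apply: contraLR inv_ij => noD; rewrite /inversion negb_and -leqNgt.
case: (ltnP i j) => //= lt_ij; rewrite -leqNgt ltnW //.
(* Without descents in between, the values increase from [i] on. *)
have asc (m : nat) (lt_mn : m < n) : i < m <= j -> pi i < pi (Ordinal lt_mn).
  elim: m lt_mn => // m IHm lt_mn /andP[lt_im le_mj].
  have lt_mn' : m < n by apply: ltnW.
  have asc_m : pi (Ordinal lt_mn') < pi (Ordinal lt_mn).
    rewrite ltnNge leq_eqVlt negb_or; apply/andP; split.
      by rewrite val_eqE (inj_eq perm_inj) -val_eqE /=; lia.
    apply: contra noD => desc_m; apply/existsP; exists (Ordinal lt_mn).
    rewrite lt_im le_mj !andbT; apply/descentsP; exists (Ordinal lt_mn') => //.
    by rewrite /inversion /= leqnn.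
  case: (ltngtP i m) => [lt_im' | | eq_im]; last 1 first.
  - by suff <- : Ordinal lt_mn' = i by []; apply: val_inj.
  - by apply: ltn_trans asc_m; apply: IHm; rewrite lt_im'; lia.
  - by lia.
have := asc j (ltn_ord j); rewrite lt_ij leqnn => /(_ isT).
by congr (_ < pi _); apply: val_inj.
Qed.

(** * Comparing block permutations *)

(** The elements that [E] has in addition to those of [D] must all be larger:
    a descent inserted before an element of [D] creates a descent bottom, which
    destroys the inversions starting there. *)
Definition initial_segment (n : nat) (D E : {set 'I_n}) : Prop :=
  forall d, d \in D -> d \in E /\ forall e : 'I_n, e \in E -> e < d -> e \in D.

Lemma initial_segment_inversion (n : nat) (D E : {set 'I_n}) (i j : 'I_n) :
  initial_segment D E ->
  inversion (block_perm D) i j -> inversion (block_perm E) i j.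
Proof.
rewrite !inversion_block_perm => DE /andP[iND /existsP[d /and3P[dD lt_id le_dj]]].
have [dE below] := DE _ dD; apply/andP; split.
  by apply: contra iND => /below; apply.
by apply/existsP; exists d; rewrite dE lt_id.
Qed.

(** At the top c = d - 1 of a descent d of [block_perm D], every later position
    forms an inversion, so the entry at c is as large as a code allows. The same
    entry for [E] can match it only if d is in [E]. An element e < d of [E] must
    be in [D]: otherwise its entry for [E] is 0 while the one for [D] counts d. *)
Lemma code_le_block_perm (n : nat) (D E : {set 'I_n}) : sparse D ->
  code_le (lehmer (block_perm D)) (lehmer (block_perm E)) <->
  initial_segment D E.
Proof.
move=> [D_gt0 D_sep]; split=> [/forallP le_DE d dD | DE]; last first.
  by apply: code_le_inversion => i j; apply: initial_segment_inversion.
have [c eq_d] := ord_predecessor (D_gt0 _ dD).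
split.
  have /eqP eq_inv : [set j | inversion (block_perm E) c j] ==
                     [set j | inversion (block_perm D) c j].
    rewrite eqEcard -!lehmerE le_DE andbT; apply/subsetP => j.
    rewrite !inE => /andP[lt_cj _].
    rewrite inversion_block_perm (D_sep _ _ eq_d dD).
    by apply/existsP; exists d; rewrite dD eq_d leqnn.
  have : d \in [set j | inversion (block_perm E) c j].
    rewrite eq_inv inE inversion_block_perm (D_sep _ _ eq_d dD).
    by apply/existsP; exists d; rewrite dD eq_d !leqnn.
  rewrite inE inversion_block_perm => /andP[_ /existsP[e /and3P[eE lt_ce le_ed]]].
  suff <- : e = d by [].
  by apply: val_inj => /=; lia.
move=> e eE lt_ed; apply: contraTT (le_DE e) => eND; rewrite -ltnNge !lehmerE.
rewrite [X in X < _]eq_card0; last first.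
  by move=> j; rewrite inE inversion_block_perm eE.
rewrite card_gt0; apply/set0Pn; exists d; rewrite inE inversion_block_perm eND.
by apply/existsP; exists d; rewrite dD lt_ed leqnn.
Qed.

(** Here inversions are counted by their right end. At d in [D] the count for [D]
    is that of all positions before d outside [D]. If the elements of [D] below d
    are in [E], only those positions can be counted for [E], so the inequality
    forces equality of the two sets. That the position d - 1 belongs to it gives d
    in [E], and that all of them start an inversion for [E] shows that [E] has no
    further element below d. *)
Lemma code_le_reverse_complement_block_perm (n : nat) (D E : {set 'I_n}) :
  sparse D ->
  code_le (lehmer (reverse_complement (block_perm D)))
          (lehmer (reverse_complement (block_perm E))) <->
  initial_segment D E.
Proof.
move=> [D_gt0 D_sep]; split=> [/forallP le_DE d | DE]; last first.
  apply: code_le_inversion => i j; rewrite !inversion_reverse_complement.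
  exact: initial_segment_inversion.
have [m] := ubnP d; elim: m d => // m IHm d lt_dm dD.
have D_below (e : 'I_n) : e \in D -> e < d -> e \in E.
  by move=> eD lt_ed; have [] := IHm e (leq_trans lt_ed lt_dm) eD.
have inv_d (i : 'I_n) : inversion (block_perm D) i d = (i \notin D) && (i < d).
  rewrite inversion_block_perm; congr (_ && _); apply/existsP/idP.
    by case=> e /and3P[_]; lia.
  by move=> lt_id; exists d; rewrite dD lt_id leqnn.
have /eqP eq_inv : [set i | inversion (block_perm E) i d] ==
                   [set i | inversion (block_perm D) i d].
  rewrite eqEcard -!lehmer_reverse_complement le_DE andbT; apply/subsetP => i.
  rewrite !inE inv_d => inv_E; move: (inv_E) => /andP[lt_id _].
  rewrite lt_id andbT; apply: contraTN inv_E => iD.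
  by rewrite inversion_block_perm D_below.
have invE (i : 'I_n) : i \notin D -> i < d -> inversion (block_perm E) i d.
  move=> iND lt_id; suff : i \in [set i | inversion (block_perm E) i d].
    by rewrite inE.
  by rewrite eq_inv inE inv_d iND.
split=> [|e eE lt_ed]; last first.
  apply: contraTT eE => /invE/(_ lt_ed).
  by rewrite inversion_block_perm => /andP[].
have [c eq_d] := ord_predecessor (D_gt0 _ dD).
have := invE _ (D_sep _ _ eq_d dD); rewrite eq_d leqnn => /(_ isT).
rewrite inversion_block_perm => /andP[_ /existsP[e /and3P[eE lt_ce le_ed]]].
suff <- : e = d by [].
by apply: val_inj => /=; lia.
Qed.

(** * Maximal codes *)

Definition maximal_sparse (n : nat) (D : {set 'I_n}) : Prop :=
  sparse D /\ forall E, sparse E -> initial_segment D E -> E = D.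

(** Both classes have the same structure: a family of codes indexed by sparse
    sets dominates the class, and inside the family the order is that of initial
    segments. Then maximality of a code depends on its index only, whatever the
    class. *)
Lemma MaxL_maximal_sparse (n : nat) (tau : vincular)
    (f : {set 'I_n} -> lehmer_code n) :
  (forall D, f D \in L_avoiding n tau) ->
  (forall q, q \in L_avoiding n tau -> exists2 D, sparse D & code_le q (f D)) ->
  (forall D E, sparse D -> code_le (f D) (f E) <-> initial_segment D E) ->
  forall p, p \in MaxL n tau <-> exists2 D, maximal_sparse D & p = f D.
Proof.
move=> fL f_dom f_le p; split=> [|[D [spD maxD] ->]]; rewrite inE.
  case/andP=> pL /forallP max_p; have [D spD le_pD] := f_dom p pL.
  have eq_p : f D = p.
    by apply/eqP; have := max_p (f D); rewrite fL le_pD.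
  exists D => //; split=> // E spE DE.
  have eq_fE : f E = p.
    apply/eqP; have := max_p (f E); rewrite fL /= => /implyP; apply.
    by rewrite -eq_p; apply/f_le.
  (* [f D] and [f E] are the same code, so the comparison also holds backwards. *)
  have ED : initial_segment E D.
    by apply/f_le; rewrite // eq_fE eq_p; apply/forallP.
  by apply/setP => d; apply/idP/idP => [/ED[] | /DE[]].
rewrite fL; apply/forallP => q; apply/implyP => qL; apply/implyP => le_Dq.
have [E spE le_qE] := f_dom q qL.
have DE : E = D.
  by apply: maxD spE _; apply/f_le => //; apply: code_le_trans le_qE.
by rewrite DE in le_qE; apply/eqP; apply: code_le_anti.
Qed.

Lemma MaxL_V32_1 (n : nat) (p : lehmer_code n) :
  p \in MaxL n V32_1 <->
  exists2 D, maximal_sparse D & p = lehmer (block_perm D).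
Proof.
apply: (MaxL_maximal_sparse (f := fun D => lehmer (block_perm D))) => [D | q | D E].
- by apply/imset_f/block_perm_avoids.
- case/imsetP=> pi av_pi ->; exists (descents (lehmer pi)).
    exact: sparse_descents.
  by apply: code_le_inversion => i j; apply: inversion_sub_block_perm.
- exact: code_le_block_perm.
Qed.

Lemma MaxL_V3_21 (n : nat) (q : lehmer_code n) :
  q \in MaxL n V3_21 <->
  exists2 D, maximal_sparse D & q = lehmer (reverse_complement (block_perm D)).
Proof.
apply: (MaxL_maximal_sparse
         (f := fun D => lehmer (reverse_complement (block_perm D)))) => [D | p | D E].
- by apply/L_avoiding_V3_21; exists (block_perm D); first exact: block_perm_avoids.
- case/L_avoiding_V3_21=> pi av_pi ->; exists (descents (lehmer pi)).
    exact: sparse_descents.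
  apply: code_le_inversion => i j; rewrite !inversion_reverse_complement.
  exact: inversion_sub_block_perm.
- exact: code_le_reverse_complement_block_perm.
Qed.

Lemma descents_MaxL_V3_21_inj (n : nat) :
  {in MaxL n V3_21 &, injective (@descents n)}.
Proof.
move=> p q /MaxL_V3_21[D [spD _] ->] /MaxL_V3_21[E [spE _] ->].
rewrite !descents_reverse_complement !descents_block_perm // => eq_Phi.
by rewrite (Phi_inj spD.1 spE.1 eq_Phi).
Qed.

Lemma F_block_perm (n : nat) (D : {set 'I_n}) :
  maximal_sparse D ->
  F (lehmer (block_perm D)) = lehmer (reverse_complement (block_perm D)).
Proof.
move=> maxD; rewrite /F /descents_inv -descents_reverse_complement.
case: pickP => /= [s /andP[sM /eqP eq_s] | no_s].
  by apply: descents_MaxL_V3_21_inj eq_s => //; apply/MaxL_V3_21; exists D.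
have := no_s (lehmer (reverse_complement (block_perm D))).
by rewrite eqxx andbT => /negP[]; apply/MaxL_V3_21; exists D.
Qed.

Theorem theorem1p4 (n : nat) (hn : 2 <= n) :
  (* F is well defined: descents is injective on MaxL n V3_21, and Phi maps
     Dset n V32_1 into Dset n V3_21 *)
  ({in MaxL n V3_21 &, injective (@descents n)} /\
   {in Dset n V32_1, forall D, Phi D \in Dset n V3_21}) /\
  (* F is a bijection from MaxL n V32_1 onto MaxL n V3_21 *)
  ({in MaxL n V32_1 &, injective (@F n)} /\
   [set F p | p in MaxL n V32_1] = MaxL n V3_21) /\
  (forall p : lehmer_code n, p \in MaxL n V32_1 ->
   forall pi : 'S_n, lehmer pi = p -> F p = lehmer (reverse_complement pi)) /\
  (forall p : lehmer_code n, p \in MaxL n V32_1 -> weight p = weight (F p)).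
Proof.
split; last split; last split.
- split; first exact: descents_MaxL_V3_21_inj.
  move=> _ /imsetP[_ /MaxL_V32_1[D maxD ->] ->].
  rewrite -descents_reverse_complement.
  by apply/imset_f/MaxL_V3_21; exists D.
- split=> [p q /MaxL_V32_1[D maxD ->] /MaxL_V32_1[E maxE ->] | ].
    rewrite !F_block_perm // => /lehmer_inj.
    by move/(can_inj (@reverse_complementK n)) ->.
  apply/setP => q; apply/imsetP/idP => [[p /MaxL_V32_1[D maxD ->] ->] | ].
    by apply/MaxL_V3_21; exists D; rewrite ?F_block_perm.
  case/MaxL_V3_21=> D maxD ->; exists (lehmer (block_perm D)).
    by apply/MaxL_V32_1; exists D.
  by rewrite F_block_perm.
- by move=> p /MaxL_V32_1[D maxD ->] pi /lehmer_inj->; rewrite F_block_perm.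
- move=> p /MaxL_V32_1[D maxD ->].
  by rewrite F_block_perm // weight_reverse_complement.
Qed.
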